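(* Let $d\ge2$, $m\ge1$, and let $\{|\psi_j^1\rangle\}_{j=1}^d,\ldots,\{|\psi_j^m\rangle\}_{j=1}^d$ be $m$ mutually unbiased bases of $\mathbb{C}^d$. Then the state $$\rho=\frac1{md}\sum_{l=1}^m\sum_{k=1}^d|\psi_k^l\rangle\langle\psi_k^l|\otimes|\psi_k^l\rangle\langle\psi_k^l|$$ on $\mathbb{C}^d\otimes\mathbb{C}^d$ lies at the kink at $\tilde{\mathcal{R}}^{(2)}=\frac1{m(d-1)}$, that is, with $K=m(d-1)$, $$\tilde{\mathcal{R}}^{(2)}(\rho)=\frac1K,\qquad\tilde{\mathcal{R}}^{(4)}(\rho)=\frac1{3K^2}+\frac2{3K^3}.$$
   Context: Mutually unbiased bases: orthonormal bases $\{|\psi_j^1\rangle\}_{j=1}^d,\ldots,\{|\psi_j^m\rangle\}_{j=1}^d$ of $\mathbb{C}^d$ are mutually unbiased if $|\langle\psi_i^k|\psi_j^l\rangle|=\frac1{\sqrt d}$ for all $i,j$ whenever $k\ne l$. Correlation matrix: fix Hermitian $d\times d$ matrices $\lambda_0=\mathbb{1},\lambda_1,\ldots,\lambda_{d^2-1}$ with $\mathrm{Tr}(\lambda_i\lambda_j)=d\,\delta_{ij}$. For a density matrix $\rho$ on $\mathbb{C}^d\otimes\mathbb{C}^d$, its correlation matrix is the real $(d^2-1)\times(d^2-1)$ matrix $T$ with $T_{ij}=\mathrm{Tr}(\rho\,\lambda_i\otimes\lambda_j)$, $1\le i,j\le d^2-1$. Normalized second and fourth moments (independent of the chosen basis):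 $$\tilde{\mathcal{R}}^{(2)}(\rho)=\frac{\mathrm{Tr}(TT^\dagger)}{(d-1)^2},\qquad \tilde{\mathcal{R}}^{(4)}(\rho)=\frac{2\,\mathrm{Tr}(TT^\dagger TT^\dagger)+\mathrm{Tr}(TT^\dagger)^2}{3(d-1)^4}.$$ Kinks: the region of the $(\tilde{\mathcal{R}}^{(2)},\tilde{\mathcal{R}}^{(4)})$-plane allowed for separable states by the constraint $\|T\|_{\mathrm{Tr}}\le d-1$ has a piecewise-defined lower boundary. The kink at $\tilde{\mathcal{R}}^{(2)}=\frac1K$ (for $1\le K\le d^2-1$) is the point $\left(\frac1K,\ \frac1{3K^2}+\frac2{3K^3}\right)$ of this lower boundary; it is the moment point of correlation matrices having exactly $K$ nonzero singular values, all equal to $\frac{d-1}{K}$. *)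

(* Defs.v *)
From mathcomp Require Export all_boot all_order all_algebra.
From mathcomp Require Export spectral sesquilinear.
From mathcomp Require Export reals.
From mathcomp.real_closed Require Export complex mxtens.

Set Implicit Arguments.
Unset Strict Implicit.
Unset Printing Implicit Defensive.

Import Order.TTheory GRing.Theory Num.Theory.
Local Open Scope ring_scope.
Local Open Scope sesquilinear_scope.

(* The definitions are stated over an arbitrary [C : numClosedFieldType], the
   library's interface for fields like the complex numbers. *)

Definition inner (C : numClosedFieldType) (n : nat) (u v : 'cV[C]_n) : C :=
  (u^t* *m v) 0 0.

Definition ketbra (C : numClosedFieldType) (n : nat) (u : 'cV[C]_n) : 'M[C]_n :=
  u *m u^t*.

(* [d] orthonormal vectors of a [d]-dimensional space automatically span it. *)
Definition orthonormal_basis (C : numClosedFieldType) (d : nat)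
    (psi : 'I_d -> 'cV[C]_d) : Prop :=
  forall i j, inner (psi i) (psi j) = (i == j)%:R.

Definition mutually_unbiased_bases (C : numClosedFieldType) (d m : nat)
    (psi : 'I_m -> 'I_d -> 'cV[C]_d) : Prop :=
  (forall k, orthonormal_basis (psi k)) /\
  (forall k l, k != l ->
   forall i j, `|inner (psi k i) (psi l j)| = 1 / sqrtC d%:R).

(* [(d ^ 2).-1.+1] equals [d ^ 2] for [d > 0]; this shape of the bound makes the
   distinguished index [ord0] and the remaining [d ^ 2 - 1] indices
   [lift ord0 i] available. *)
Definition hermitian_basis (C : numClosedFieldType) (d : nat)
    (lam : 'I_(d ^ 2).-1.+1 -> 'M[C]_d) : Prop :=
  [/\ forall i, lam i \is hermsymmx,
      lam ord0 = 1%:M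
    & forall i j, \tr (lam i *m lam j) = d%:R * (i == j)%:R].

Definition density_matrix (C : numClosedFieldType) (n : nat) (rho : 'M[C]_n) :
    Prop :=
  [/\ rho \is hermsymmx,
      forall v : 'cV[C]_n, 0 <= inner v (rho *m v)
    & \tr rho = 1].

(* The entries are real when [rho] and the [lam i] are Hermitian, see
   [correlation_real]; they are kept in [C] so that no real part is taken. *)
Definition correlation (C : numClosedFieldType) (d : nat)
    (lam : 'I_(d ^ 2).-1.+1 -> 'M[C]_d) (rho : 'M[C]_(d * d)) :
    'M[C]_((d ^ 2).-1) :=
  \matrix_(i, j) \tr (rho *m (lam (lift ord0 i) *t lam (lift ord0 j))).

Definition moment2 (C : numClosedFieldType) (d : nat)
    (lam : 'I_(d ^ 2).-1.+1 -> 'M[C]_d) (rho : 'M[C]_(d * d)) : C :=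
  let T := correlation lam rho in
  \tr (T *m T^t*) / (d%:R - 1) ^+ 2.

Definition moment4 (C : numClosedFieldType) (d : nat)
    (lam : 'I_(d ^ 2).-1.+1 -> 'M[C]_d) (rho : 'M[C]_(d * d)) : C :=
  let T := correlation lam rho in
  (2 * \tr (T *m T^t* *m T *m T^t*) + \tr (T *m T^t*) ^+ 2)
    / (3 * (d%:R - 1) ^+ 4).

Definition mub_state (C : numClosedFieldType) (d m : nat)
    (psi : 'I_m -> 'I_d -> 'cV[C]_d) : 'M[C]_(d * d) :=
  (m%:R * d%:R)^-1 *:
    \sum_(l < m) \sum_(k < d) (ketbra (psi l k) *t ketbra (psi l k)).

Lemma hermsymmxP (C : numClosedFieldType) n (A : 'M[C]_n) :
  reflect (A^t* = A) (A \is hermsymmx).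
Proof.
rewrite qualifE /= expr0 scale1r eq_sym; exact: eqP.
Qed.

Lemma adj_tens (C : numClosedFieldType) m n p q (A : 'M[C]_(m, n))
  (B : 'M[C]_(p, q)) : (A *t B)^t* = A^t* *t B^t*.
Proof. by rewrite trmx_tens map_mxT. Qed.

Lemma adj_mul (C : numClosedFieldType) m n p (A : 'M[C]_(m, n))
  (B : 'M[C]_(n, p)) : (A *m B)^t* = B^t* *m A^t*.
Proof. by rewrite trmx_mul map_mxM. Qed.

Lemma adjK (C : numClosedFieldType) m n (A : 'M[C]_(m, n)) : (A^t*)^t* = A.
Proof. by apply/matrixP=> i j; rewrite !mxE conjCK. Qed.

Lemma correlation_real (C : numClosedFieldType) d
    (lam : 'I_(d ^ 2).-1.+1 -> 'M[C]_d) (rho : 'M[C]_(d * d)) :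
  hermitian_basis lam -> density_matrix rho ->
  correlation lam rho \is a realmx.
Proof.
case=> herm _ _ [/hermsymmxP rhoH _ _]; apply/mxOverP=> i j.
rewrite mxE CrealE; set B := _ *t _.
have BH : B^t* = B by rewrite adj_tens !(hermsymmxP _ (herm _)).
apply/eqP; rewrite -[in RHS]BH -[in RHS]rhoH -adj_mul.
by rewrite trace_map_mx mxtrace_tr mxtrace_mulC.
Qed.

Lemma mub_state_density (C : numClosedFieldType) d m
    (psi : 'I_m -> 'I_d -> 'cV[C]_d) :
  (2 <= d)%N -> (1 <= m)%N -> mutually_unbiased_bases psi ->
  density_matrix (mub_state psi).
Proof.
move=> d2 m1 [ON _]; have md0 : m%:R * d%:R != 0 :> C.
  by rewrite mulf_neq0 // pnatr_eq0 -lt0n // ltnW.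
have ketE l k : ketbra (psi l k) *t ketbra (psi l k) =
    (psi l k *t psi l k) *m (psi l k *t psi l k)^t*.
  by rewrite adj_tens -tensmx_mul.
split.
- apply/hermsymmxP; rewrite /mub_state linearZ /= map_mxZ fmorphV rmorphM.
  rewrite !rmorph_nat /=; congr (_ *: _).
  rewrite raddf_sum map_mx_sum; apply: eq_bigr => l _ /=.
  rewrite raddf_sum map_mx_sum; apply: eq_bigr => k _ /=.
  by rewrite ketE adj_mul adjK.
- move=> v; rewrite /inner /mub_state -scalemxAl -scalemxAr mxE.
  rewrite mulr_ge0 ?invr_ge0 ?mulr_ge0 ?ler0n //.
  rewrite mulmx_suml mulmx_sumr summxE; apply: sumr_ge0 => l _.
  rewrite mulmx_suml mulmx_sumr summxE; apply: sumr_ge0 => k _.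
  set A := psi l k *t psi l k.
  have -> : v^t* *m (ketbra (psi l k) *t ketbra (psi l k) *m v) =
      (A^t* *m v)^t* *m (A^t* *m v).
    by rewrite ketE adj_mul adjK !mulmxA.
  rewrite mxE; apply: sumr_ge0 => i _; rewrite !mxE mulrC; exact: mul_conjC_ge0.
- rewrite /mub_state linearZ /= -[RHS](mulVf md0); congr (_ * _).
  rewrite raddf_sum /= (eq_bigr (fun=> d%:R)); last first.
    move=> l _; rewrite raddf_sum /= (eq_bigr (fun=> 1)); last first.
      move=> k _; rewrite ketE mxtrace_mulC adj_tens tensmx_mul.
      rewrite /mxtrace big_ord1 mxE !ord1; have := ON l k k.
      by rewrite /inner eqxx => ->; rewrite mulr1.
    by rewrite sumr_const card_ord.
  by rewrite sumr_const card_ord mulr_natl.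
Qed.

(* Main.v *)
(** Let V_l be the real matrix whose columns are the Bloch vectors of the l-th
    basis, so that T = (V_1 V_1^T + ... + V_m V_m^T) / (m d).  By Parseval for
    the lambda_i, V_l^T V_l = d 1 - J with J the all-ones matrix, while
    unbiasedness is exactly V_l^T V_l' = 0 for l != l'; moreover V_l J = 0, as
    the Bloch vectors of an orthonormal basis sum to 0.  Hence the
    V_l V_l^T / d are mutually orthogonal projections of trace d - 1, and
    Q = m T is an orthogonal projection of trace K = m (d - 1).  This gives
    both moments, and K <= d^2 - 1 because Q has size d^2 - 1. *)

Require Import Defs.
From mathcomp Require Import ring.

Set Implicit Arguments.
Unset Strict Implicit.
Unset Printing Implicit Defensive.

Import Order.TTheory GRing.Theory Num.Theory.
Local Open Scope ring_scope.

(** * Flattened matrices and the Parseval identity for the trace form *)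

Lemma sum_mxtens (R : nmodType) m n (F : 'I_m -> 'I_n -> R) :
  \sum_(k < m * n) F (mxtens_unindex k).1 (mxtens_unindex k).2 =
  \sum_i \sum_j F i j.
Proof.
rewrite pair_bigA /= [RHS](reindex (@mxtens_unindex m n)) //=.
by exists (@mxtens_index m n) => k _; rewrite (mxtens_indexK, mxtens_unindexK).
Qed.

Lemma mxtrace_tens (R : comNzRingType) m n (A : 'M[R]_m) (B : 'M[R]_n) :
  \tr (A *t B) = \tr A * \tr B.
Proof. by rewrite /mxtrace mulr_sum; apply: eq_bigr => k _; rewrite mxE. Qed.

Lemma mxtrace_mul_mxtens (R : comNzRingType) m n (A : 'M[R]_(m, n)) (B : 'M[R]_(n, m)) :
  \tr (A *m B) = \sum_(k < m * n)
    A (mxtens_unindex k).1 (mxtens_unindex k).2 *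
    B (mxtens_unindex k).2 (mxtens_unindex k).1.
Proof.
rewrite (sum_mxtens (fun i j => A i j * B j i)).
by apply: eq_bigr => i _; rewrite mxE.
Qed.

(* The dual family of a trace-orthogonal one is a right inverse of a square
   matrix, hence also a left inverse. *)
Lemma trace_basis_parseval (F : fieldType) d n (c : F) (lam : 'I_n -> 'M[F]_d) :
  n = (d * d)%N -> c != 0 ->
  (forall i j, \tr (lam i *m lam j) = c * (i == j)%:R) ->
  forall A B : 'M[F]_d,
  \sum_i \tr (A *m lam i) * \tr (B *m lam i) = c * \tr (A *m B).
Proof.
move=> en; subst n => c0 orth A B.
(* [L] has the flattened [lam i] as rows and [M] their flattened transposes as columns, so [L *m M]
   is the Gram matrix of the trace form. *)
pose L := \matrix_(i, k)
  lam i (mxtens_unindex k).1 (mxtens_unindex k).2 : 'M[F]_(d * d).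
pose M := \matrix_(k, i)
  lam i (mxtens_unindex k).2 (mxtens_unindex k).1 : 'M[F]_(d * d).
pose a := \row_k A (mxtens_unindex k).1 (mxtens_unindex k).2 : 'rV[F]_(d * d).
pose b := \col_k B (mxtens_unindex k).2 (mxtens_unindex k).1 : 'cV[F]_(d * d).
have LM : (c^-1 *: L) *m M = 1%:M.
  apply/matrixP=> i j; rewrite -scalemxAl !mxE.
  under eq_bigr do rewrite !mxE.
  by rewrite -mxtrace_mul_mxtens orth mulKf.
have ML : M *m L = c%:M.
  by rewrite -scalemx1 -(mulmx1C LM) -scalemxAr scalerA divff // scale1r.
have -> : \tr (A *m B) = (a *m b) 0 0.
  by rewrite mxtrace_mul_mxtens mxE; apply: eq_bigr => k _; rewrite !mxE.
transitivity ((a *m M *m (L *m b)) 0 0).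
  rewrite mxE; apply: eq_bigr => i _; rewrite [\tr (B *m _)]mxtrace_mulC.
  rewrite !mxtrace_mul_mxtens !mxE.
  by congr (_ * _); apply: eq_bigr => k _; rewrite !mxE.
by rewrite mulmxA -(mulmxA a) ML mul_mx_scalar -scalemxAl mxE.
Qed.

(** * Rank-one projectors and Hermitian projections *)

Section Adjoint.
Variable C : numClosedFieldType.
Local Open Scope sesquilinear_scope.

Lemma inner_conj n (u v : 'cV[C]_n) : inner v u = (inner u v)^*.
Proof.
rewrite /inner !mxE rmorph_sum; apply: eq_bigr => i _.
by rewrite rmorphM !mxE /= conjCK mulrC.
Qed.

Lemma mxtrace_ketbra n (u : 'cV[C]_n) : \tr (ketbra u) = inner u u.
Proof. by rewrite mxtrace_mulC trace_mx11. Qed.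

Lemma mxtrace_ketbra_mul n (u v : 'cV[C]_n) :
  \tr (ketbra u *m ketbra v) = `|inner u v| ^+ 2.
Proof.
rewrite /ketbra mulmxA mxtrace_mulC !mulmxA -mulmxA trace_mx11 mxE big_ord1.
by rewrite -/(inner v u) -/(inner u v) inner_conj normCK mulrC.
Qed.

(** With the vectors as columns of [U], orthonormality is [U^t* *m U = 1%:M]; the reversed product
    [U *m U^t*] is the sum of projectors. *)
Lemma sum_ketbra d (psi : 'I_d -> 'cV[C]_d) :
  orthonormal_basis psi -> \sum_k ketbra (psi k) = 1%:M.
Proof.
move=> ON; pose U := \matrix_(i, k) psi k i 0.
have : U^t* *m U = 1%:M.
  apply/matrixP=> i j; rewrite !mxE -ON /inner mxE.
  by apply: eq_bigr => k _; rewrite !mxE.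
move/mulmx1C <-; apply/matrixP=> i j; rewrite summxE !mxE.
by apply: eq_bigr => k _; rewrite !mxE big_ord1 !mxE.
Qed.

(** The complement [P] is again a Hermitian projection, so its trace is that of [P *m P^t*], a sum
    of squared moduli. *)
Lemma hermitian_proj_trace_le n (Q : 'M[C]_n) :
  Q^t* = Q -> Q *m Q = Q -> \tr Q <= n%:R.
Proof.
move=> QH QQ; set P := 1%:M - Q.
have PH : P^t* = P by rewrite /P linearB /= map_mxB trmx1 map_mx1 QH.
have PP : P *m P = P by rewrite mulmxBl mul1mx mulmxBr mulmx1 QQ subrr subr0.
rewrite -subr_ge0 -(mxtrace1 C n) -raddfB -/P -PP -{2}PH.
apply: sumr_ge0 => i _; rewrite mxE; apply: sumr_ge0 => j _.
by rewrite !mxE mul_conjC_ge0.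
Qed.

End Adjoint.

(** * Bloch vectors of orthonormal bases and their projections *)

Section BlochMatrix.
Variables (C : numClosedFieldType) (d : nat).
Variable lam : 'I_(d ^ 2).-1.+1 -> 'M[C]_d.
Hypotheses (d2 : (2 <= d)%N) (lamP : hermitian_basis lam).

(* The columns are the Bloch vectors of the states [psi k]. *)
Definition bloch (psi : 'I_d -> 'cV[C]_d) : 'M[C]_((d ^ 2).-1, d) :=
  \matrix_(i, k) \tr (ketbra (psi k) *m lam (lift ord0 i)).

Let d0 : d%:R != 0 :> C. Proof. by rewrite pnatr_eq0 -lt0n ltnW. Qed.

(** This is Parseval for the two projectors; the subtracted product is the term of
    [lam ord0 = 1%:M], which the Bloch vectors omit. *)
Lemma bloch_gram psi phi k l :
  ((bloch psi)^T *m bloch phi) k l =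
  d%:R * `|inner (psi k) (phi l)| ^+ 2
    - inner (psi k) (psi k) * inner (phi l) (phi l).
Proof.
have [_ lam0 orth] := lamP; have en : (d ^ 2).-1.+1 = (d * d)%N.
  by rewrite prednK ?expn_gt0 ?(ltnW d2) // expnS expn1.
rewrite -mxtrace_ketbra_mul -(trace_basis_parseval en d0 orth) big_ord_recl.
rewrite lam0 !mulmx1 !mxtrace_ketbra addrC addKr mxE.
by apply: eq_bigr => i _; rewrite !mxE.
Qed.

Lemma bloch_gram_same psi : orthonormal_basis psi ->
  (bloch psi)^T *m bloch psi = d%:R%:M - const_mx 1.
Proof.
move=> ON; apply/matrixP=> k l; rewrite bloch_gram !ON !eqxx !mxE mulr1.
by case: eqP; rewrite /= ?normr1 ?normr0 ?expr1n ?expr0n ?mulr1 ?mulr0.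
Qed.

Lemma bloch_gram_unbiased psi phi :
  orthonormal_basis psi -> orthonormal_basis phi ->
  (forall i j, `|inner (psi i) (phi j)| = 1 / sqrtC d%:R) ->
  (bloch psi)^T *m bloch phi = 0.
Proof.
move=> ON1 ON2 U; apply/matrixP=> k l; rewrite bloch_gram ON1 ON2 U !eqxx.
by rewrite mxE expr_div_n sqrtCK expr1n mulr1 div1r mulfV // subrr.
Qed.

Lemma bloch_const psi : orthonormal_basis psi ->
  bloch psi *m const_mx 1 = 0 :> 'M_(_, d).
Proof.
have [_ lam0 orth] := lamP.
move=> ON; apply/matrixP=> i j; rewrite !mxE.
under eq_bigr do rewrite !mxE mulr1.
(* The projectors sum to the identity, that is to [lam ord0], which is trace-orthogonal to every
   other [lam] element. *)
rewrite -raddf_sum -mulmx_suml sum_ketbra // mul1mx -[lam _]mulmx1 -lam0 /= orth.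
by rewrite mulr0.
Qed.

(** The transpose can stand for the adjoint because Bloch vectors are real for Hermitian [lam]. *)
Definition bloch_proj psi := d%:R^-1 *: (bloch psi *m (bloch psi)^T).

Lemma bloch_proj_idem psi : orthonormal_basis psi ->
  bloch_proj psi *m bloch_proj psi = bloch_proj psi.
Proof.
move=> ON; rewrite /bloch_proj -scalemxAl -scalemxAr mulmxA.
rewrite -(mulmxA (bloch psi)) bloch_gram_same // mulmxBr bloch_const // subr0.
by rewrite mul_mx_scalar -scalemxAl (scalerA _ d%:R) mulVf // scale1r.
Qed.

Lemma bloch_proj_orth psi phi :
  orthonormal_basis psi -> orthonormal_basis phi ->
  (forall i j, `|inner (psi i) (phi j)| = 1 / sqrtC d%:R) ->
  bloch_proj psi *m bloch_proj phi = 0.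
Proof.
move=> ON1 ON2 U; rewrite /bloch_proj -scalemxAl -scalemxAr mulmxA.
by rewrite -(mulmxA (bloch psi)) bloch_gram_unbiased // mulmx0 mul0mx !scaler0.
Qed.

Lemma bloch_proj_trace psi : orthonormal_basis psi ->
  \tr (bloch_proj psi) = d%:R - 1.
Proof.
move=> ON; rewrite linearZ /= mxtrace_mulC bloch_gram_same // raddfB /=.
rewrite mxtrace_scalar /mxtrace; under [X in _ - X]eq_bigr do rewrite mxE.
by rewrite sumr_const card_ord; field.
Qed.

Lemma bloch_proj_tr psi : (bloch_proj psi)^T = bloch_proj psi.
Proof. by rewrite linearZ /= trmx_mul trmxK. Qed.

(** The trace of a tensor product factors, so each product state contributes the outer square of its
    Bloch vector; the factor [d%:R^-1] goes into [bloch_proj]. *)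
Lemma correlation_mub_state m (psi : 'I_m -> 'I_d -> 'cV[C]_d) :
  correlation lam (mub_state psi) = m%:R^-1 *: \sum_l bloch_proj (psi l).
Proof.
rewrite -scaler_sumr scalerA -invfM.
apply/matrixP=> i j; rewrite !mxE /mub_state -scalemxAl linearZ /=.
congr (_ * _); rewrite mulmx_suml raddf_sum summxE; apply: eq_bigr => l _.
rewrite mulmx_suml raddf_sum mxE; apply: eq_bigr => k _ /=.
by rewrite tensmx_mul mxtrace_tens !mxE.
Qed.

End BlochMatrix.

(** * The rescaled correlation matrix as a projection, and its moments *)

Section MubCorrelation.
Variables (C : numClosedFieldType) (d m : nat).
Variables (lam : 'I_(d ^ 2).-1.+1 -> 'M[C]_d) (psi : 'I_m -> 'I_d -> 'cV[C]_d).
Hypotheses (d2 : (2 <= d)%N) (m1 : (1 <= m)%N).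
Hypotheses (lamP : hermitian_basis lam) (mub : mutually_unbiased_bases psi).
Local Open Scope sesquilinear_scope.

Let m0 : m%:R != 0 :> C. Proof. by rewrite pnatr_eq0 -lt0n. Qed.
Let T := correlation lam (mub_state psi).
Let Q := m%:R *: T.

Let QE : Q = \sum_l bloch_proj lam (psi l).
Proof. by rewrite /Q /T correlation_mub_state scalerA mulfV // scale1r. Qed.

Let TE : T = m%:R^-1 *: Q.
Proof. by rewrite scalerA mulVf // scale1r. Qed.

Lemma mub_proj_idem : Q *m Q = Q.
Proof.
have [ON U] := mub; rewrite QE mulmx_suml; apply: eq_bigr => l _.
rewrite mulmx_sumr (bigD1 l) //= bloch_proj_idem // big1 ?addr0 // => k kl.
by rewrite bloch_proj_orth // => i j; rewrite U // eq_sym.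
Qed.

Lemma mub_proj_trace : \tr Q = (m * (d - 1))%:R.
Proof.
have [ON _] := mub; rewrite QE raddf_sum /=.
under eq_bigr do rewrite bloch_proj_trace //.
by rewrite sumr_const card_ord -[LHS]mulr_natl natrM natrB ?(ltnW d2).
Qed.

(** [T] is real, as the correlation matrix of a density matrix, and symmetric, as a combination of
    symmetric projections. *)
Lemma mub_correlation_herm : T^t* = T.
Proof.
have T_real := correlation_real lamP (mub_state_density d2 m1 mub).
suff -> : T^T = T by rewrite realmxC.
rewrite TE QE linearZ /= raddf_sum /=; congr (_ *: _).
by apply: eq_bigr => l _; rewrite bloch_proj_tr.
Qed.

Lemma mub_moment_bound : (m * (d - 1) <= d ^ 2 - 1)%N.
Proof.
rewrite -(ler_nat C) -mub_proj_trace subn1; apply: hermitian_proj_trace_le.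
  by rewrite /Q linearZ /= map_mxZ rmorph_nat mub_correlation_herm.
exact: mub_proj_idem.
Qed.

Lemma mub_correlation_sqr : T *m T^t* = m%:R^-2 *: Q.
Proof.
rewrite mub_correlation_herm TE -scalemxAl -scalemxAr mub_proj_idem scalerA.
by rewrite -expr2 exprVn.
Qed.

Lemma mxtrace_mub_correlation2 : \tr (T *m T^t*) = (d%:R - 1) / m%:R.
Proof.
rewrite mub_correlation_sqr linearZ /= mub_proj_trace natrM natrB ?(ltnW d2) //.
by field.
Qed.

Lemma mxtrace_mub_correlation4 :
  \tr (T *m T^t* *m T *m T^t*) = (d%:R - 1) / m%:R ^+ 3.
Proof.
(* Grouped as the square of [T *m T^t*], the product is [m%:R^-4 *: Q]; the factor [m] in the trace
   of [Q] leaves the cube. *)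
rewrite -(mulmxA (T *m _)) mub_correlation_sqr -scalemxAl -scalemxAr.
rewrite mub_proj_idem scalerA linearZ /= mub_proj_trace natrM natrB ?(ltnW d2) //.
by field.
Qed.

End MubCorrelation.

Theorem theorem5 (R : realType) (d m : nat)
    (lam : 'I_(d ^ 2).-1.+1 -> 'M[R[i]]_d)
    (psi : 'I_m -> 'I_d -> 'cV[R[i]]_d) :
  (2 <= d)%N -> (1 <= m)%N ->
  hermitian_basis lam ->
  mutually_unbiased_bases psi ->
  let K := (m * (d - 1))%N in
  [/\ (1 <= K <= d ^ 2 - 1)%N,
      moment2 lam (mub_state psi) = 1 / K%:R
    & moment4 lam (mub_state psi)
        = 1 / (3 * K%:R ^+ 2) + 2 / (3 * K%:R ^+ 3)].
Proof.
move=> d2 m1 lamP mub K.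
have m0 : m%:R != 0 :> R[i] by rewrite pnatr_eq0 -lt0n.
have d1 : d%:R - 1 != 0 :> R[i].
  by rewrite subr_eq0 (eqr_nat _ d 1) gtn_eqF.
have KE : K%:R = m%:R * (d%:R - 1) :> R[i] by rewrite natrM natrB ?(ltnW d2).
split.
- by rewrite (mub_moment_bound d2 m1 lamP mub) muln_gt0 m1 subn_gt0 d2.
- rewrite /moment2 (mxtrace_mub_correlation2 d2 m1 lamP mub) KE.
  by field; rewrite m0 d1.
(* The fourth-order trace yields [2 / (3 * K%:R ^+ 3)], the squared second-order trace
   [1 / (3 * K%:R ^+ 2)]. *)
- rewrite /moment4 (mxtrace_mub_correlation2 d2 m1 lamP mub).
  rewrite (mxtrace_mub_correlation4 d2 m1 lamP mub) KE.
  by field; rewrite m0 d1.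
Qed.
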